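(* Let $X,Y$ be Banach spaces and let $u:\mathbb{R}_{\ge 0}\to\mathcal{L}(X;Y)$ be a function. Then the following are equivalent: (a) for each $x\in X$ there is $t_x\ge 0$ such that the orbit $u_x$ is differentiable on $(t_x,\infty)$; (b) there is $t\ge 0$ such that for all $x\in X$ the orbit $u_x$ is differentiable on $(t,\infty)$.
   Context: $X,Y$ are Banach spaces over the same field $\mathbb{R}$ or $\mathbb{C}$; $\mathcal{L}(X;Y)$ is the space of bounded linear operators from $X$ to $Y$; $\mathbb{R}_{\ge 0}=[0,\infty)$. No continuity or other regularity of $u$ is assumed. For $x\in X$, the orbit is the function $u_x:\mathbb{R}_{\ge 0}\to Y$, $u_x(t)=u(t)x$. Differentiable on an interval means differentiable (in the norm of $Y$) at each point of the interval. *)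

(* Defs.v *)
From HB Require Import structures.
From mathcomp Require Import all_boot all_order all_algebra.
From mathcomp Require Import complex.
From mathcomp Require Import all_classical all_reals all_analysis.

Set Implicit Arguments.
Unset Strict Implicit.
Unset Printing Implicit Defensive.

Import Order.TTheory GRing.Theory Num.Theory.
Import numFieldNormedType.Exports.

Local Open Scope classical_set_scope.
Local Open Scope ring_scope.

Variant scalar_kind := RealScalars | ComplexScalars.

Definition scalar_field (R : realType) (k : scalar_kind) : numFieldType :=
  match k with
  | RealScalars => R
  | ComplexScalars => R[i]
  end.

Definition of_real (R : realType) (k : scalar_kind) : R -> scalar_field R k :=
  match k return R -> scalar_field R k with
  | RealScalars => id
  | ComplexScalars => real_complex R
  end.

(* The library's [derivable] requires source and target to be normed over the
   same field, so it does not cover functions of a real variable with values in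
   a complex space: the increment is cast into the scalar field instead. *)
Definition derivable_at (R : realType) (k : scalar_kind)
    (Y : normedModType (scalar_field R k)) (f : R -> Y) (s : R) : Prop :=
  cvg ((fun h : R => (of_real k h)^-1 *: (f (h + s) - f s)) @ 0^').

Lemma derivable_at_realE (R : realType) (Y : normedModType R) (f : R -> Y)
    (s : R) :
  @derivable_at R RealScalars Y f s <-> derivable f s 1.
Proof.
rewrite /derivable_at /derivable /=.
suff -> : (fun h : R => h^-1 *: ((f \o shift s) (h *: (1 : R)) - f s)) =
          (fun h : R => h^-1 *: (f (h + s) - f s)) by [].
by apply/funext => h /=; rewrite /GRing.scale/= mulr1.
Qed.

Definition operator_orbit (R : realType) (k : scalar_kind)
    (X Y : normedModType (scalar_field R k)) (u : R -> {linear X -> Y}) (x : X) :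
    R -> Y :=
  fun t => u t x.

(* Main.v *)
Require Import Defs.
From HB Require Import structures.
From mathcomp Require Import all_boot all_order all_algebra.
From mathcomp Require Import complex.
From mathcomp Require Import all_classical all_reals all_analysis.

Set Implicit Arguments.
Unset Strict Implicit.
Unset Printing Implicit Defensive.

Import Order.TTheory GRing.Theory Num.Theory.
Import numFieldNormedType.Exports.

Local Open Scope classical_set_scope.
Local Open Scope ring_scope.

(** Differentiability at one time is a convergence property of a family of
    bounded operators: it holds on all of X or only on a meagre set.

    Fix s > 0 and let D_s be the subspace of all x whose orbit is
    differentiable at s, that is, for which the difference quotients
    q_h x = (u (h + s) x - u s x) / h converge as h -> 0.  Either D_s is the
    whole of X, or D_s is meagre ([differentiability_set_dichotomy], a case of
    [cvg_set_dichotomy]).  Indeed D_s is covered by the closed sets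
    C_n = {x | |q_h x| <= n whenever 0 < |h| < s / (n + 1)}, since convergent
    quotients are bounded near 0.  If every C_n has empty interior, D_s is
    meagre.  If some C_n contains a ball, linearity makes the q_h with small h
    uniformly bounded in operator norm ([linear_bound_of_ball]); then
    pointwise convergence passes to limits, so D_s is closed, and a proper
    closed subspace has empty interior ([subspace_interior]).

    Now let A_n be the set of all x whose orbit is differentiable on
    (n, +oo).  If no t is uniform in x, then for each n some s > n has
    D_s <> X, so that A_n, being contained in D_s, is meagre.  Since X is
    complete, some x lies outside all A_n ([exists_notin_meagre_seq]), and no
    t_x can exist for this x.  Only one time s is chosen for each n, so the
    exceptional sets stay countable in number although time is continuous. *)

(** * Baire category over an archimedean scalar field *)

Lemma scalar_field_archimedean (R : realType) (k : scalar_kind) :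
  Num.archimedean_axiom (scalar_field R k).
Proof.
case: k => /= x.
  by exists (Num.truncn `|x|).+1; exact: truncnS_gt.
have /complex_realP[r xr] := normr_real x.
exists (Num.truncn r).+1; rewrite xr -(rmorph_nat (real_complex R)) ltcR.
exact: truncnS_gt.
Qed.

Lemma archimedean_inv (K : numFieldType) (archiK : Num.archimedean_axiom K)
    (e : K) : 0 < e -> exists n, n.+1%:R^-1 < e.
Proof.
move=> e0; have [n] := archiK e^-1; rewrite gtr0_norm ?invr_gt0// => en.
exists n; rewrite invf_plt ?posrE ?ltr0n// (lt_trans en)// ltr_nat.
exact: ltnSn.
Qed.

(** The order of [K] may be only partial, as for complex scalars; the complement
    of a closed half-line is a half-line because norms are real. *)
Lemma closed_norm_le (K : numFieldType) (X : topologicalType)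
    (Y : normedModType K) (f : X -> Y) (c : K) :
  continuous f -> c \is Num.real -> closed [set x | `|f x| <= c].
Proof.
move=> cf cr x clx /=; apply: contrapT => /negP.
rewrite -real_ltNge ?normr_real// => cfx.
have : nbhs x [set y | `|f x - f y| < `|f x| - c].
  have /cvgrPdist_lt := cf x; apply; by rewrite subr_gt0.
move=> /clx[y [/= yc]]; apply/negP.
rewrite -real_leNgt ?rpredB ?normr_real//.
by rewrite (le_trans _ (lerB_dist _ _))// lerB.
Qed.

(** The inductive step of Baire's theorem: a closed set with empty interior
    misses some point of the given ball, hence a small ball around it.  The
    pair [p] is the center and the radius of this smaller ball. *)
Lemma closed_interior0_sub_ball (K : numFieldType) (X : normedModType K)
    (C : set X) (a : X) (r d : K) :
  closed C -> C° = set0 -> 0 < r -> 0 < d ->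
  exists p : X * K, [/\ 0 < p.2, p.2 < d &
    forall y, `|p.1 - y| <= p.2 -> `|a - y| <= r /\ ~ C y].
Proof.
move=> clC C0 r0 d0.
have [b [abr nCb]] : exists b, `|a - b| < r /\ ~ C b.
  apply: contrapT => H; have : C° a.
    apply/nbhs_normP; exists r => //= b abr.
    by apply: contrapT => nCb; apply: H; exists b.
  by rewrite C0.
have : nbhs b (~` C) by apply: open_nbhs_nbhs; split => //; exact: closed_openC.
move=> /nbhs_normP[e /= e0 be].
near (0 : K)^'+ => t; exists (b, t); split => //= y byt; split.
  rewrite (le_trans (ler_distD b _ _))// -lerBrDl (le_trans byt)//.
  by near: t; apply: nbhs_right_le; rewrite subr_gt0.
by apply: be => /=; rewrite (le_lt_trans byt).
Unshelve. all: by end_near. Qed.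

(** Baire's theorem for scalars that need not be totally ordered; nested balls
    avoiding [C 0], [C 1], ... shrink to the required point. *)
Lemma baire_avoid_closed (K : numFieldType) (archiK : Num.archimedean_axiom K)
    (X : completeNormedModType K) (C : nat -> set X) :
  (forall n, closed (C n)) -> (forall n, (C n)° = set0) ->
  exists x, forall n, ~ C n x.
Proof.
move=> clC C0.
have /choice[next nextP] (p : nat * (X * K)) : exists q : X * K, 0 < p.2.2 ->
    [/\ 0 < q.2, q.2 < p.1.+1%:R^-1 & forall y,
      `|q.1 - y| <= q.2 -> `|p.2.1 - y| <= p.2.2 /\ ~ C p.1 y].
  have [p0|np0] := pselect (0 < p.2.2); last by exists p.2 => /np0.
  have i0 : 0 < p.1.+1%:R^-1 :> K by rewrite invr_gt0 ltr0n.
  by have [q] := closed_interior0_sub_ball p.2.1 (clC p.1) (C0 p.1) p0 i0; exists q.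
(* [br n] is a ball (center, radius) that avoids [C m] for all m < n. *)
pose fix br n : X * K := if n is m.+1 then next (m, br m) else (0, 1).
have br_gt0 n : 0 < (br n).2.
  by elim: n => [|n IH]; [exact: ltr01|case: (nextP (n, br n) IH)].
have brS n : (br n.+1).2 < n.+1%:R^-1 /\ forall y,
    `|(br n.+1).1 - y| <= (br n.+1).2 ->
    `|(br n).1 - y| <= (br n).2 /\ ~ C n y.
  by case: (nextP (n, br n) (br_gt0 n)).
have nested n m y : (n <= m)%N ->
    `|(br m).1 - y| <= (br m).2 -> `|(br n).1 - y| <= (br n).2.
  elim: m => [|m IH]; first by rewrite leqn0 => /eqP ->.
  rewrite leq_eqVlt => /orP[/eqP->//|nm] ym; apply: IH => //.
  by case: (brS m) => _ /(_ _ ym)[].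
have near_center n m : (n <= m)%N -> `|(br n).1 - (br m).1| <= (br n).2.
  by move=> nm; apply: nested nm _; rewrite subrr normr0 ltW.
have /cvg_ex[l al] : cvg ((fun n => (br n).1) @ \oo).
  apply: cauchy_cvg; apply: cauchy_exP => e e0.
  have [n ne] := archimedean_inv archiK e0.
  exists (br n.+1).1; exists n.+1 => // m /= nm.
  rewrite -ball_normE /ball_ /=.
  by rewrite (le_lt_trans (near_center _ _ nm))// (lt_trans (brS n).1).
exists l => n.
have ln m : `|(br m).1 - l| <= (br m).2.
  have clm : closed [set y | `|(br m).1 - y| <= (br m).2].
    apply: closed_norm_le; last by rewrite gtr0_real.
    by move=> y; apply: cvgB; [exact: cvg_cst|exact: cvg_id].
  apply: (closed_cvg _ clm _ _ al); exists m => // i /= mi; exact: near_center.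
by have [_ /(_ _ (ln n.+1))[]] := brS n.
Qed.

Definition meagre (X : topologicalType) (A : set X) :=
  exists C : nat -> set X,
    [/\ forall n, closed (C n), forall n, (C n)° = set0 &
        A `<=` \bigcup_n C n].

Lemma exists_notin_meagre_seq (K : numFieldType)
    (archiK : Num.archimedean_axiom K) (X : completeNormedModType K)
    (A : nat -> set X) :
  (forall n, meagre (A n)) -> exists x, forall n, ~ A n x.
Proof.
move=> /choice[C CP].
(* A doubly indexed family of closed sets, enumerated as a single sequence. *)
pose D i := if unpickle i is Some (n, m) then C n m else set0.
have [i||x xD] := @baire_avoid_closed K archiK X D.
- rewrite /D; case: unpickle => [[n m]|]; last exact: closed0.
  by have [] := CP n.
- move=> i; rewrite /D; case: unpickle => [[n m]|]; last first.
    by apply/seteqP; split => // x /interior_subset.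
  by have [] := CP n.
exists x => n; have [_ _ AC] := CP n => /AC[m _ Cx].
by apply: (xD (pickle (n, m))); rewrite /D pickleK.
Qed.

(** * Pointwise convergence of families of operators *)

(** If [D] contains a ball around [x0], it contains [x0 + c z] for small
    [c != 0], and [z] is a combination of this vector and [x0]. *)
Lemma subspace_interior (K : numFieldType) (X : normedModType K) (D : set X) :
  (forall (a : K) x y, D x -> D y -> D (a *: x + y)) ->
  D° !=set0 -> D = setT.
Proof.
move=> Dlin [x0 x0D]; apply/seteqP; split => // z _.
have Dx0 : D x0 := interior_subset x0D.
have : (fun c : K => c *: z + x0) @ nbhs (0 : K) --> 0 *: z + x0.
  apply: (@cvgD _ _ _ (nbhs (0 : K))); last exact: cvg_cst.
  by apply: (@cvgZr_tmp _ _ _ (nbhs (0 : K))); exact: cvg_id.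
rewrite scale0r add0r => /(_ _ x0D) /= H.
near (0 : K)^' => c.
have c0 : c != 0 by near: c; exact: nbhs_dnbhs_neq.
have Dc : D (c *: z + x0) by near: c; apply: nbhs_dnbhs; exact: H.
have := Dlin (-1) _ _ Dx0 Dc; rewrite scaleN1r addrC addrK => Dcz.
have D0 : D 0 by have := Dlin (-1) _ _ Dx0 Dx0; rewrite scaleN1r addNr.
by have := Dlin c^-1 _ _ Dcz D0; rewrite addr0 scalerA mulVf// scale1r.
Unshelve. all: by end_near. Qed.

(** A linear map bounded by [M] on a ball around [x0] is bounded by [2 M] on the
    ball of the same radius around 0, as [z = (x0 + z) - x0].  The constant
    comes from rescaling [z] to norm [r / 2]. *)
Lemma linear_bound_of_ball (K : numFieldType) (X Y : normedModType K)
    (f : {linear X -> Y}) (x0 : X) (r M : K) :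
  0 < r -> (forall y, `|x0 - y| < r -> `|f y| <= M) ->
  forall z, `|f z| <= (2 * M) * (2 / r) * `|z|.
Proof.
move=> r0 fM z; have [->|z0] := eqVneq z 0.
  by rewrite linear0 !normr0 mulr0.
have nz : 0 < `|z| by rewrite normr_gt0.
pose c := r / 2 / `|z|.
have c0 : 0 < c by rewrite !divr_gt0.
have : `|f (x0 + c *: z) - f x0| <= 2 * M.
  rewrite (le_trans (ler_normB _ _))// mulr2n mulrDl mul1r.
  rewrite lerD// fM// ?subrr ?normr0//.
  rewrite opprD addNKr normrN normrZ gtr0_norm// /c divfK ?normr_eq0//.
  by rewrite ltr_pdivrMr// ltr_pMr// ltr1n.
rewrite linearD addrAC subrr add0r linearZ normrZ gtr0_norm//.
rewrite -ler_pdivlMl// => /le_trans; apply.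
by rewrite -mulrA mulrC /c invfM invrK invf_div.
Qed.

(** A uniform boundedness principle for the set of convergence along a filter
    with a countable base.  The countable base is what makes the cover [C] of
    [D] countable, so that meagreness can be concluded. *)
Lemma cvg_set_dichotomy (K : numFieldType) (archiK : Num.archimedean_axiom K)
    (X : normedModType K) (Y : completeNormedModType K) (T : Type)
    (F : set_system T) (FF : ProperFilter F) (B : nat -> set T)
    (q : T -> {linear X -> Y}) :
  (forall n, F (B n)) -> (forall A, F A -> exists n, B n `<=` A) ->
  (forall m n, (m <= n)%N -> B n `<=` B m) ->
  (forall h, B 0%N h -> continuous (q h)) ->
  let D := [set x | cvg ((fun h => q h x) @ F)] in
  D = setT \/ meagre D.
Proof.
move=> FB Bbase Bdecr qcont D.
have Dlin (a : K) x y : D x -> D y -> D (a *: x + y).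
  move=> Dx Dy; rewrite /D /=.
  under eq_fun do rewrite linearP.
  by apply: is_cvgD => //; apply: is_cvgZl_tmp.
have [->|DT] := pselect (D = setT); [by left|right].
pose C n := [set x | forall h, B n h -> `|q h x| <= n%:R].
have clC n : closed (C n).
  have -> : C n = \bigcap_(h in B n) [set x | `|q h x| <= n%:R].
    by apply/seteqP; split => x Cx h; exact: Cx.
  apply: closed_bigI => h Bh; apply: closed_norm_le; last exact: realn.
  by apply: qcont; apply: Bdecr Bh.
have DC : D `<=` \bigcup_n C n.
  move=> x /cvg_ex[l /cvg_bounded /pinfty_ex_gt0[M M0 FM]].
  have [m BM] := Bbase _ FM.
  have [p Mp] := archiK M; rewrite gtr0_norm// in Mp.
  exists (maxn m p) => // h Bh.
  have /BM/= := Bdecr _ _ (leq_maxl m p) _ Bh.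
  move=> /le_trans; apply; rewrite (le_trans (ltW Mp))// ler_nat.
  exact: leq_maxr.
have [C0|] := pselect (forall n, (C n)° = set0); first by exists C.
move=> /existsNP[n /eqP/set0P[x0 /nbhs_normP[r /= r0 rC]]].
(* Equicontinuity on [B n] makes the proper subspace [D] itself closed. *)
exists (fun=> D); split => [_|_|]; last by move=> x Dx; exists 0%N.
  (* Adding 1 keeps the common Lipschitz constant positive when n = 0. *)
  pose L : K := 2 * n%:R * (2 / r) + 1.
  have L0 : 0 < L.
    by rewrite ltr_wpDl// !mulr_ge0 ?invr_ge0 ?ler0n// ltW.
  have qL h : B n h -> forall z, `|q h z| <= L * `|z|.
    move=> Bh z.
    have bnd : forall y, `|x0 - y| < r -> `|q h y| <= n%:R.
      by move=> y /rC; exact.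
    rewrite (le_trans (linear_bound_of_ball r0 bnd z))//.
    by rewrite ler_wpM2r// lerDl.
  move=> x clx; rewrite /D /=.
  apply: cauchy_cvg; apply: cauchy_exP => e e0.
  have eL : 0 < e / 2 / L by rewrite !divr_gt0.
  have [d [Dd /= xd]] := clx _ (nbhsx_ballx x _ eL).
  have /cvg_ex[l dl] := Dd.
  exists l.
  have Fd : F [set h | `|l - q h d| < e / 2].
    by have /cvgrPdist_lt := dl; apply; rewrite divr_gt0.
  apply: (filterS _ (filterI (FB n) Fd)) => h [/= Bh ld].
  rewrite -ball_normE /ball_ /=.
  rewrite (le_lt_trans (ler_distD (q h d) _ _))// (splitr e) ltrD//.
  rewrite -linearB (le_lt_trans (qL _ Bh _))// -ltr_pdivlMl//.
  by move: xd; rewrite -ball_normE /ball_ /= distrC mulrC.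
by apply: contrapT => /eqP/set0P D0; apply: DT; exact: subspace_interior.
Qed.

(** * Differentiability of the orbits *)

Lemma continuous_scale_sub (K : numFieldType) (X Y : normedModType K)
  (a : K) (f g : X -> Y) : continuous f -> continuous g ->
  continuous (a \*: (f \- g)).
Proof.
move=> cf cg x.
by apply: cvgZl_tmp; apply: cvgB; [exact: cf|exact: cg].
Qed.

Lemma differentiability_set_dichotomy (R : realType) (k : scalar_kind)
    (X : normedModType (scalar_field R k))
    (Y : completeNormedModType (scalar_field R k)) (u : R -> {linear X -> Y})
    (s : R) :
  (forall t : R, 0 <= t -> continuous (u t)) -> 0 < s ->
  let D := [set x | derivable_at (operator_orbit u x) s] in
  D = setT \/ meagre D.
Proof.
move=> ucont s0.
pose q (h : R) : {linear X -> Y} := (of_real k h)^-1 \*: (u (h + s) \- u s).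
(* |h| < s keeps h + s positive, where [u (h + s)] is continuous. *)
pose B n := [set h : R | `|h| < s / n.+1%:R /\ h != 0].
apply: (@cvg_set_dichotomy _ (@scalar_field_archimedean R k) X Y R (0 : R)^' _ B q).
- move=> n; have sn : 0 < s / n.+1%:R by rewrite divr_gt0.
  near=> h; split; first by near: h; exact: dnbhs0_lt.
  by near: h; exact: nbhs_dnbhs_neq.
- move=> A /nbhs_norm0P[e /= e0 eA].
  have [n ne] : exists n, n.+1%:R^-1 < e / s.
    apply: (archimedean_inv (@scalar_field_archimedean R RealScalars)).
    by rewrite divr_gt0.
  exists n => h [hs h0]; apply: eA => //=.
  by rewrite (lt_trans hs)// mulrC -ltr_pdivlMr.
- move=> m n mn h [hs h0]; split => //; rewrite (lt_le_trans hs)//.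
  by rewrite ler_pM2l// lef_pV2 ?posrE ?ltr0n// ler_nat.
- move=> h [hs _]; apply: continuous_scale_sub; apply: ucont; last exact: ltW.
  rewrite -lerBlDr sub0r; apply: ltW.
  by move: hs; rewrite divr1 ltr_norml => /andP[].
Unshelve. all: by end_near. Qed.

Theorem proposition3p11 (R : realType) (k : scalar_kind)
    (X Y : completeNormedModType (scalar_field R k))
    (* [u t] is only constrained, and only ever used, for t >= 0 *)
    (u : R -> {linear X -> Y})
    (u_bounded : forall t : R, 0 <= t -> bounded_near (u t) (nbhs (0 : X))) :
  (forall x : X, exists tx : R, 0 <= tx /\
     forall s : R, tx < s -> derivable_at (operator_orbit u x) s)
  <->
  (exists t : R, 0 <= t /\
     forall x : X, forall s : R, t < s -> derivable_at (operator_orbit u x) s).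
Proof.
split=> [orbit_diff|[t [t0 tP]] x]; last by exists t; split => // s; exact: tP.
have ucont t (t0 : 0 <= t) : continuous (u t).
  exact/bounded_linear_continuous/u_bounded.
pose A (n : nat) :=
  [set x : X | forall s : R, n%:R < s -> derivable_at (operator_orbit u x) s].
apply: contrapT => not_uniform.
have Ameagre n : meagre (A n).
  have [s [ns [x xs]]] : exists s : R, n%:R < s /\
      exists x, ~ derivable_at (operator_orbit u x) s.
    apply: contrapT => H; apply: not_uniform; exists n%:R; split => // x s ns.
    by apply: contrapT => xs; apply: H; exists s; split => //; exists x.
  have s0 : 0 < s by rewrite (le_lt_trans _ ns).
  have [DT|[C [clC C0 DC]]] := differentiability_set_dichotomy ucont s0.
    by have : [set: X] x by []; rewrite -DT.
  by exists C; split => // y Ay; apply: DC; exact: Ay.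
have [x xA] := exists_notin_meagre_seq (@scalar_field_archimedean R k) Ameagre.
have [t [t0 tP]] := orbit_diff x.
apply: (xA (Num.truncn t).+1) => s ns; apply: tP.
by rewrite (lt_trans _ ns)// truncnS_gt.
Qed.
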